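(* Let $n\ge 1$. Every local $\frac12$-derivation of the complex Lie algebra $\mathfrak{L}_{n,n+1}$ is a $\frac12$-derivation.
   Context: All algebras are over $\mathbb{C}$. A linear map $D:\mathfrak{L}\to\mathfrak{L}$ on a Lie algebra is a $\frac12$-derivation if $D[x,y]=\frac12\big([D(x),y]+[x,D(y)]\big)$ for all $x,y\in\mathfrak{L}$. A linear map $\Delta:\mathfrak{L}\to\mathfrak{L}$ is a local $\frac12$-derivation if for every $x\in\mathfrak{L}$ there is a $\frac12$-derivation $D_x$ (depending on $x$) with $\Delta(x)=D_x(x)$. $\mathfrak{L}_{n,n+1}$ is the $(3n+2)$-dimensional solvable Lie algebra with basis $\{e_1,\dots,e_{2n+1},x_1,\dots,x_{n+1}\}$ and brackets, for $1\le i\le n$: $[e_{n+i},e_i]=e_{2n+1}$, $[e_i,x_i]=e_i$, $[e_{n+i},x_i]=-e_{n+i}$, $[e_i,x_{n+1}]=e_i$, and $[e_{2n+1},x_{n+1}]=e_{2n+1}$; brackets of basis elements not obtained from these by antisymmetry are zero. (Its nilradical is the Heisenberg algebra spanned by $e_1,\dots,e_{2n+1}$.) *)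

(* Defs.v *)
From HB Require Import structures.
From mathcomp Require Import all_boot all_order all_algebra.
From mathcomp Require Import ring.
From mathcomp Require Import complex reals.

Set Implicit Arguments.
Unset Strict Implicit.
Unset Printing Implicit Defensive.

Import GRing.Theory.
Local Open Scope ring_scope.

HB.mixin Record Lmodule_isLie (K : fieldType) (L : Type)
    of GRing.Lmodule K L := {
  lie : L -> L -> L;
  lie_linearl : forall y, linear (fun x => lie x y);
  lie_linearr : forall x, linear (lie x);
  liexx : forall x, lie x x = 0;
  lie_jacobi : forall x y z,
    lie x (lie y z) + lie y (lie z x) + lie z (lie x y) = 0
}.

#[short(type="lieAlgType")]
HB.structure Definition LieAlgebra (K : fieldType) :=
  {L of GRing.Lmodule K L & Lmodule_isLie K L}.

Definition half_derivation (K : fieldType) (L : lieAlgType K)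
    (D : {linear L -> L}) : Prop :=
  forall x y, D (lie x y) = 2^-1 *: (lie (D x) y + lie x (D y)).

Definition local_half_derivation (K : fieldType) (L : lieAlgType K)
    (Delta : {linear L -> L}) : Prop :=
  forall x, exists2 D : {linear L -> L}, half_derivation D & Delta x = D x.

(* Coordinates of a vector are ordered as
     e_1, ..., e_n, e_{n+1}, ..., e_{2n}, e_{2n+1}, x_1, ..., x_n, x_{n+1};
   ordinals count from 0, so i : 'I_n stands for the index i + 1. *)
Definition Lnn1 (K : fieldType) (n : nat) : Type :=
  'rV[K]_((n + n + 1) + (n + 1)).

HB.instance Definition _ (K : fieldType) (n : nat) :=
  Vector.copy (Lnn1 K n) 'rV[K]_((n + n + 1) + (n + 1)).

Section Lnn1.
Variables (K : fieldType) (n : nat).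
Local Notation L := (Lnn1 K n).
Local Notation idx := ('I_((n + n + 1) + (n + 1))).

(* Positions of e_i, e_{n+i}, e_{2n+1}, x_i and x_{n+1}, for 1 <= i <= n. *)
Definition ie (i : 'I_n) : idx := lshift (n + 1) (lshift 1 (lshift n i)).
Definition ien (i : 'I_n) : idx := lshift (n + 1) (lshift 1 (rshift n i)).
Definition iez : idx := lshift (n + 1) (rshift (n + n) ord0).
Definition ix (i : 'I_n) : idx := rshift (n + n + 1) (lshift 1 i).
Definition ixz : idx := rshift (n + n + 1) (rshift n ord0).

Definition Lbase (p : idx) : L := delta_mx 0 p.

(* The coefficient of [Lbase p, Lbase q] in the expansion of [u, v] over pairs
   of basis vectors, [Lbase q, Lbase p] being counted with the opposite sign. *)
Definition Lminor (u v : L) (p q : idx) : K := u 0 p * v 0 q - u 0 q * v 0 p.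

Definition Lnn1_lie (u v : L) : L :=
  \sum_(i < n)
    (  Lminor u v (ien i) (ie i) *: Lbase iez
     + Lminor u v (ie i) (ix i) *: Lbase (ie i)
     + Lminor u v (ien i) (ix i) *: - Lbase (ien i)
     + Lminor u v (ie i) ixz *: Lbase (ie i))
  + Lminor u v iez ixz *: Lbase iez.

Variant idx_spec : idx -> Type :=
  | Idx_e i : idx_spec (ie i)
  | Idx_en i : idx_spec (ien i)
  | Idx_ez : idx_spec iez
  | Idx_x i : idx_spec (ix i)
  | Idx_xz : idx_spec ixz.

Lemma idxP p : idx_spec p.
Proof.
case: (split_ordP p) => q ->; case: (split_ordP q) => r ->.
- by case: (split_ordP r) => i ->; [exact: Idx_e | exact: Idx_en].
- by rewrite (ord1 r); exact: Idx_ez.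
- exact: Idx_x.
- by rewrite (ord1 r); exact: Idx_xz.
Qed.

Lemma eq_idx :
  (((forall i j, (ie i == ie j) = (i == j)) *
   (forall i j, (ie i == ien j) = false) *
   (forall i, (ie i == iez) = false) *
   (forall i j, (ie i == ix j) = false) *
   (forall i, (ie i == ixz) = false) *
   (forall i j, (ien i == ie j) = false) *
   (forall i j, (ien i == ien j) = (i == j)) *
   (forall i, (ien i == iez) = false) *
   (forall i j, (ien i == ix j) = false) *
   (forall i, (ien i == ixz) = false) *
   (forall i, (iez == ie i) = false) *
   (forall i, (iez == ien i) = false) *
   (forall i, (iez == ix i) = false) *
   ((iez == ixz) = false) *
   (forall i j, (ix i == ie j) = false) *
   (forall i j, (ix i == ien j) = false) *
   (forall i, (ix i == iez) = false) *
   (forall i j, (ix i == ix j) = (i == j)) *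
   (forall i, (ix i == ixz) = false) *
   (forall i, (ixz == ie i) = false) *
   (forall i, (ixz == ien i) = false) *
   ((ixz == iez) = false) *
   (forall i, (ixz == ix i) = false))%type).
Proof.
by do !split; move=> *; rewrite ?(eq_lshift, eq_rshift, eq_lrshift, eq_rlshift).
Qed.

Lemma Lbase_coord p q : Lbase p 0 q = (q == p)%:R.
Proof. by rewrite mxE eqxx. Qed.

Lemma Lnn1_lieE u v q : Lnn1_lie u v 0 q =
  \sum_(i < n)
    (  Lminor u v (ien i) (ie i) * (q == iez)%:R
     + Lminor u v (ie i) (ix i) * (q == ie i)%:R
     - Lminor u v (ien i) (ix i) * (q == ien i)%:R
     + Lminor u v (ie i) ixz * (q == ie i)%:R)
  + Lminor u v iez ixz * (q == iez)%:R.
Proof.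
rewrite /Lnn1_lie mxE summxE; congr (_ + _); last by rewrite mxE Lbase_coord.
apply: eq_bigr => i _.
by rewrite !(mxE, Lbase_coord) !eqxx !andTb mulrN.
Qed.

Lemma Lnn1_lie_e u v i :
  Lnn1_lie u v 0 (ie i) = Lminor u v (ie i) (ix i) + Lminor u v (ie i) ixz.
Proof.
rewrite Lnn1_lieE (bigD1 i) //= big1 => [|j ji]; rewrite !eq_idx ?eqxx /=.
  by ring.
by rewrite eq_sym (negPf ji) /=; ring.
Qed.

Lemma Lnn1_lie_en u v i :
  Lnn1_lie u v 0 (ien i) = - Lminor u v (ien i) (ix i).
Proof.
rewrite Lnn1_lieE (bigD1 i) //= big1 => [|j ji]; rewrite !eq_idx ?eqxx /=.
  by ring.
by rewrite eq_sym (negPf ji) /=; ring.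
Qed.

Lemma Lnn1_lie_ez u v :
  Lnn1_lie u v 0 iez =
  \sum_(i < n) Lminor u v (ien i) (ie i) + Lminor u v iez ixz.
Proof.
rewrite Lnn1_lieE eqxx mulr1; congr (_ + _); apply: eq_bigr => i _.
by rewrite !eq_idx /=; ring.
Qed.

Lemma Lnn1_lie_x u v i : Lnn1_lie u v 0 (ix i) = 0.
Proof.
by rewrite Lnn1_lieE big1 => [|j _]; rewrite !eq_idx /=; ring.
Qed.

Lemma Lnn1_lie_xz u v : Lnn1_lie u v 0 ixz = 0.
Proof.
by rewrite Lnn1_lieE big1 => [|j _]; rewrite !eq_idx /=; ring.
Qed.

Definition Lnn1_coordE :=
  (Lnn1_lie_e, Lnn1_lie_en, Lnn1_lie_ez, Lnn1_lie_x, Lnn1_lie_xz).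

Lemma Lminor_linearl a u u' v p q :
  Lminor (a *: u + u') v p q = a * Lminor u v p q + Lminor u' v p q.
Proof. by rewrite /Lminor !mxE; ring. Qed.

Lemma LminorC u v p q : Lminor v u p q = - Lminor u v p q.
Proof. by rewrite /Lminor; ring. Qed.

Lemma Lnn1_lieC u v : Lnn1_lie v u = - Lnn1_lie u v.
Proof.
apply/rowP => q; rewrite [RHS]mxE !Lnn1_lieE opprD -sumrN [in LHS]LminorC mulNr.
congr (_ + _); apply: eq_bigr => i _.
by rewrite ![Lminor v u _ _]LminorC; ring.
Qed.

Lemma Lnn1_lie_linearl v : linear (fun u => Lnn1_lie u v).
Proof.
move=> a u u'; apply/rowP => q; rewrite [RHS]mxE [X in _ = X + _]mxE !Lnn1_lieE.
rewrite [a * (\sum_(i < n) _ + _)]mulrDr mulr_sumr (Lminor_linearl _ _ _ _ iez).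
rewrite addrACA -big_split /=; congr (_ + _); last by ring.
by apply: eq_bigr => i _; rewrite !Lminor_linearl; ring.
Qed.

Lemma Lnn1_lie_linearr u : linear (Lnn1_lie u).
Proof.
move=> a v v'; rewrite !(Lnn1_lieC _ u) Lnn1_lie_linearl.
by rewrite opprD scalerN.
Qed.

Lemma Lnn1_liexx u : Lnn1_lie u u = 0.
Proof.
have minor0 p q : Lminor u u p q = 0 by rewrite /Lminor; ring.
apply/rowP => q; rewrite Lnn1_lieE minor0 big1 ?mxE; first by ring.
by move=> i _; rewrite !minor0; ring.
Qed.

Lemma Lnn1_lie_lie_ez u v w :
  Lnn1_lie u (Lnn1_lie v w) 0 iez =
  \sum_(i < n)
    (  u 0 (ien i) * (Lminor v w (ie i) (ix i) + Lminor v w (ie i) ixz)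
     + u 0 (ie i) * Lminor v w (ien i) (ix i)
     - Lminor v w (ien i) (ie i) * u 0 ixz)
  - Lminor v w iez ixz * u 0 ixz.
Proof.
rewrite big_split /= sumrN -mulr_suml -addrA -opprD -mulrDl Lnn1_lie_ez.
congr (_ + _).
  by apply: eq_bigr => i _; rewrite [LHS]/Lminor !Lnn1_coordE; ring.
by rewrite [LHS]/Lminor !Lnn1_coordE; ring.
Qed.

Lemma Lnn1_lie_jacobi u v w :
  Lnn1_lie u (Lnn1_lie v w) + Lnn1_lie v (Lnn1_lie w u)
    + Lnn1_lie w (Lnn1_lie u v) = 0.
Proof.
apply/rowP => q; rewrite [LHS]mxE [X in X + _]mxE [RHS]mxE.
case: (idxP q) => [i|i||i|]; last 2 first.
- by rewrite !Lnn1_lie_x; ring.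
- by rewrite !Lnn1_lie_xz; ring.
- by rewrite !Lnn1_lie_e /Lminor !Lnn1_coordE /Lminor; ring.
- by rewrite !Lnn1_lie_en /Lminor !Lnn1_coordE /Lminor; ring.
rewrite !Lnn1_lie_lie_ez [X in X + _]addrACA -big_split /=.
rewrite addrACA -big_split /=.
rewrite big1 => [|i _]; rewrite /Lminor; ring.
Qed.

HB.instance Definition _ := Lmodule_isLie.Build K L
  Lnn1_lie_linearl Lnn1_lie_linearr Lnn1_liexx Lnn1_lie_jacobi.

Lemma lie_coordE u v : lie u v = Lnn1_lie u v. Proof. by []. Qed.

Lemma Lminor_base p q r s : Lminor (Lbase p) (Lbase q) r s =
  (r == p)%:R * (s == q)%:R - (s == p)%:R * (r == q)%:R.
Proof. by rewrite /Lminor !Lbase_coord. Qed.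

Lemma Lnn1P (u v : L) :
  (forall i, u 0 (ie i) = v 0 (ie i)) ->
  (forall i, u 0 (ien i) = v 0 (ien i)) ->
  u 0 iez = v 0 iez -> (forall i, u 0 (ix i) = v 0 (ix i)) ->
  u 0 ixz = v 0 ixz -> u = v.
Proof. by move=> *; apply/rowP => p; case: (idxP p). Qed.

Ltac lie_base :=
  apply: Lnn1P => [k|k||k|];
  rewrite ?lie_coordE ?Lnn1_coordE [RHS]mxE ?Lbase_coord;
  rewrite ?Lminor_base ?eq_idx ?eqxx /= ?mulr0 ?oppr0 ?addr0;
  try (rewrite big1 => [|l _]; rewrite ?Lminor_base ?eq_idx /=);
  try by ring.

Lemma lie_e_e i j : lie (Lbase (ie i)) (Lbase (ie j)) = 0.
Proof. by lie_base. Qed.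

Lemma lie_en_en i j : lie (Lbase (ien i)) (Lbase (ien j)) = 0.
Proof. by lie_base. Qed.

Lemma lie_e_ez i : lie (Lbase (ie i)) (Lbase iez) = 0.
Proof. by lie_base. Qed.

Lemma lie_en_ez i : lie (Lbase (ien i)) (Lbase iez) = 0.
Proof. by lie_base. Qed.

Lemma lie_ez_x i : lie (Lbase iez) (Lbase (ix i)) = 0.
Proof. by lie_base. Qed.

Lemma lie_en_xz i : lie (Lbase (ien i)) (Lbase ixz) = 0.
Proof. by lie_base. Qed.

Lemma lie_x_x i j : lie (Lbase (ix i)) (Lbase (ix j)) = 0.
Proof. by lie_base. Qed.

Lemma lie_x_xz i : lie (Lbase (ix i)) (Lbase ixz) = 0.
Proof. by lie_base. Qed.

Lemma lie_ez_xz : lie (Lbase iez) (Lbase ixz) = Lbase iez.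
Proof. by lie_base. Qed.

Lemma lie_e_xz i : lie (Lbase (ie i)) (Lbase ixz) = Lbase (ie i).
Proof. by lie_base. Qed.

Lemma lie_e_x i j :
  lie (Lbase (ie i)) (Lbase (ix j)) = if i == j then Lbase (ie i) else 0.
Proof.
have [<-|ij] := eqVneq i j; lie_base.
all: have [E|_] := eqVneq k i; rewrite ?E ?(negPf ij) /=; ring.
Qed.

Lemma lie_en_x i j :
  lie (Lbase (ien i)) (Lbase (ix j)) = if i == j then - Lbase (ien i) else 0.
Proof.
have [<-|ij] := eqVneq i j; lie_base.
all: have [E|_] := eqVneq k i; rewrite ?E ?(negPf ij) /=; ring.
Qed.

Lemma lie_en_e i j :
  lie (Lbase (ien i)) (Lbase (ie j)) = if i == j then Lbase iez else 0.
Proof.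
have sum1 : \sum_(k < n) Lminor (Lbase (ien i)) (Lbase (ie j)) (ien k) (ie k)
    = (i == j)%:R.
  rewrite (bigD1 i) //= big1 => [|k ki]; rewrite Lminor_base !eq_idx.
    by rewrite eqxx /=; ring.
  by rewrite (negPf ki) /=; ring.
have [ij|ij] := eqVneq i j; apply: Lnn1P => [k|k||k|];
  rewrite ?lie_coordE ?Lnn1_coordE ?sum1 [RHS]mxE ?Lbase_coord ?Lminor_base;
  by rewrite ?eq_idx ?ij ?(negPf ij) ?eqxx /=; ring.
Qed.

End Lnn1.

(* Main.v *)
Require Import Defs.
From HB Require Import structures.
From mathcomp Require Import all_boot all_order all_algebra.
From mathcomp Require Import ring.
From mathcomp Require Import complex reals.

Set Implicit Arguments.
Unset Strict Implicit.
Unset Printing Implicit Defensive.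

Import GRing.Theory.
Local Open Scope ring_scope.
Local Open Scope complex_scope.

(** The algebra has very few 1/2-derivations: over any field with 2 invertible
    they are exactly the maps D v = a v + c v(x_{n+1}) e_{2n+1}, where
    v(x_{n+1}) is the coordinate of v on x_{n+1}
    ([half_derivation_Lnn1P]).

    The torus T spanned by the x_i acts on the e_p with the pairwise distinct
    nonzero weights eps_i + delta for e_i, - eps_i for e_{n+i} and delta for
    e_{2n+1}. Taking the e_gamma-coordinate of 2 D[e_beta, h] =
    [D e_beta, h] + [e_beta, D h] for h in T gives an equation with factor
    2 beta - gamma on the coefficient of D e_beta on e_gamma. Together with
    the relations [D h, h'] = [D h', h] for h, h' in T, this makes
    each e_beta an eigenvector of D. Its eigenvalue is beta(t) / beta(h), where
    t is the torus part of D h; since the weight of e_{2n+1} is the sum of those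
    of e_i and e_{n+i}, all these eigenvalues agree. Every coordinate of the
    D h is then determined by brackets with the basis, except for the component
    of D x_{n+1} on e_{2n+1}: that vector commutes with all e_p and with all
    x_i other than x_{n+1}, so this component stays free.

    Given this form, a local 1/2-derivation Delta satisfies: Delta v lies in
    the span of v and v(x_{n+1}) e_{2n+1} for every v. Hence each basis vector
    other than x_{n+1} is an eigenvector of Delta, and evaluating Delta on sums
    of two basis vectors shows that the eigenvalues coincide with each other
    and with the coefficient of Delta x_{n+1} on x_{n+1}. So Delta has the
    form above, and is a 1/2-derivation. *)

(** * Brackets and their coordinates *)

Section Bilinear.
Variables (K : fieldType) (L : lieAlgType K).
Implicit Types (a : K) (u v : L).

Lemma lieDl u u' v : lie (u + u') v = lie u v + lie u' v.
Proof. by have := lie_linearl v 1 u u'; rewrite !scale1r. Qed.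

Lemma lieDr u v v' : lie u (v + v') = lie u v + lie u v'.
Proof. by have := lie_linearr u 1 v v'; rewrite !scale1r. Qed.

Lemma lieZl a u v : lie (a *: u) v = a *: lie u v.
Proof.
have lie0 : lie 0 v = 0 by apply: (addrI (lie 0 v)); rewrite -lieDl !addr0.
by have := lie_linearl v a u 0; rewrite lie0 !addr0.
Qed.

Lemma lieZr a u v : lie u (a *: v) = a *: lie u v.
Proof.
have lie0 : lie u 0 = 0 by apply: (addrI (lie u 0)); rewrite -lieDr !addr0.
by have := lie_linearr u a v 0; rewrite lie0 !addr0.
Qed.

End Bilinear.

Section BracketCoordinates.
Variables (K : fieldType) (n : nat).
Implicit Types (v : Lnn1 K n) (i j k : 'I_n).
Local Notation "''b_' p" := (@Lbase K n p) (at level 8, p at level 2).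

Lemma lie_r_xz v :
  (forall k, lie v 'b_(ixz n) 0 (ie k) = v 0 (ie k)) *
  (forall k, lie v 'b_(ixz n) 0 (ien k) = 0) *
  (lie v 'b_(ixz n) 0 (iez n) = v 0 (iez n)).
Proof.
split; [split=> k|]; rewrite lie_coordE Lnn1_coordE.
all: rewrite ?big1 => *; rewrite /Lminor !Lbase_coord !eq_idx ?eqxx /=; ring.
Qed.

Lemma lie_r_x v j :
  (forall k, lie v 'b_(ix j) 0 (ie k) = (k == j)%:R * v 0 (ie k)) *
  (forall k, lie v 'b_(ix j) 0 (ien k) = - ((k == j)%:R * v 0 (ien k))) *
  (lie v 'b_(ix j) 0 (iez n) = 0).
Proof.
split; [split=> k|]; rewrite lie_coordE Lnn1_coordE.
all: rewrite ?big1 => *; rewrite /Lminor !Lbase_coord !eq_idx ?eqxx /=; ring.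
Qed.

Lemma lie_l_ez v :
  (forall k, lie 'b_(iez n) v 0 (ie k) = 0) *
  (forall k, lie 'b_(iez n) v 0 (ien k) = 0) *
  (lie 'b_(iez n) v 0 (iez n) = v 0 (ixz n)).
Proof.
split; [split=> k|]; rewrite lie_coordE Lnn1_coordE.
all: rewrite ?big1 => *; rewrite /Lminor !Lbase_coord !eq_idx ?eqxx /=; ring.
Qed.

Lemma lie_l_e v i :
  (forall k, lie 'b_(ie i) v 0 (ie k) =
     (k == i)%:R * (v 0 (ix k) + v 0 (ixz n))) *
  (forall k, lie 'b_(ie i) v 0 (ien k) = 0) *
  (lie 'b_(ie i) v 0 (iez n) = - v 0 (ien i)).
Proof.
split; [split=> k|]; rewrite lie_coordE Lnn1_coordE; last first.
  rewrite (bigD1 i) //= big1 => [|k ki];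
    rewrite /Lminor !Lbase_coord !eq_idx ?eqxx /=; first by ring.
  by rewrite (negPf ki) /=; ring.
all: by rewrite /Lminor !Lbase_coord !eq_idx ?eqxx /=; ring.
Qed.

Lemma lie_l_en v i :
  (forall k, lie 'b_(ien i) v 0 (ie k) = 0) *
  (forall k, lie 'b_(ien i) v 0 (ien k) = - ((k == i)%:R * v 0 (ix k))) *
  (lie 'b_(ien i) v 0 (iez n) = v 0 (ie i)).
Proof.
split; [split=> k|]; rewrite lie_coordE Lnn1_coordE; last first.
  rewrite (bigD1 i) //= big1 => [|k ki];
    rewrite /Lminor !Lbase_coord !eq_idx ?eqxx /=; first by ring.
  by rewrite (negPf ki) /=; ring.
all: by rewrite /Lminor !Lbase_coord !eq_idx ?eqxx /=; ring.
Qed.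

Lemma lie_x_coord u v i : lie u v 0 (ix i) = 0.
Proof. exact: Lnn1_lie_x. Qed.

Lemma lie_xz_coord u v : lie u v 0 (ixz n) = 0.
Proof. exact: Lnn1_lie_xz. Qed.

Lemma lieC u v : lie v u = - lie u v :> Lnn1 K n.
Proof. exact: Lnn1_lieC. Qed.

Lemma Lbase_sum v : v = \sum_p v 0 p *: 'b_p.
Proof. exact: row_sum_delta. Qed.

End BracketCoordinates.

(** * The 1/2-derivations of the algebra *)

Section HalfDerivations.
Variables (K : fieldType) (n : nat).
Hypothesis two_neq0 : 2 != 0 :> K.
Local Notation L := (Lnn1 K n).
Local Notation "''b_' p" := (@Lbase K n p) (at level 8, p at level 2).
Local Notation w := (ixz n).
Local Notation z := (iez n).

Definition lie_baseE := (@lie_r_xz K n, @lie_r_x K n, @lie_l_ez K n,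
  @lie_l_e K n, @lie_l_en K n, @lie_x_coord K n, @lie_xz_coord K n).

Lemma eq_double_self (x : K) : 2 * x = x -> x = 0.
Proof. by rewrite -[X in _ = X -> _]addr0 mulrDl mul1r => /addrI. Qed.

Section Classification.
Variable D : {linear L -> L}.
Hypothesis hD : half_derivation D.

Lemma half_derivation_coord (x y : L) q :
  2 * D (lie x y) 0 q = lie (D x) y 0 q + lie x (D y) 0 q.
Proof. by rewrite hD !mxE mulrA divff ?mul1r. Qed.
Local Notation hDq := half_derivation_coord.

(** Both sides act from the right, so that on the torus one reads off
    coordinates of D x and D y directly. *)
Lemma half_derivation_commute (x y : L) q :
  lie x y = 0 -> lie (D x) y 0 q = lie (D y) x 0 q.
Proof.
move=> xy0; have := hDq x y q.
rewrite xy0 linear0 [lie x _]lieC !mxE mulr0 => /esym/eqP.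
by rewrite subr_eq0 => /eqP.
Qed.
Local Notation hDc := half_derivation_commute.

(** Since x_i and x_{n+1} commute, [D x_i, x_{n+1}] = [D x_{n+1}, x_i]; the
    vectors e_i and e_{n+i} are told apart by x_{n+1}, which kills only the
    second one. *)
Lemma half_derivation_xz_nil i :
  D 'b_w 0 (ie i) = D 'b_(ix i) 0 (ie i) /\ D 'b_w 0 (ien i) = 0.
Proof.
have br q := hDc q (lie_x_xz K i); split.
  by have := br (ie i); rewrite !lie_baseE eqxx mul1r.
have /esym/eqP := br (ien i).
by rewrite !lie_baseE eqxx mul1r oppr_eq0 => /eqP.
Qed.

(** The bracket with x_{n+1} is the identity or zero on each e_p, hence
    2 D e_i = [D e_i, x_{n+1}] + [e_i, D x_{n+1}] removes the off-diagonal
    coordinates; the bracket with x_i computes the eigenvalue. *)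
Lemma half_derivation_e i :
  D 'b_(ie i) = (D 'b_(ix i) 0 (ix i) + D 'b_(ix i) 0 w) *: 'b_(ie i).
Proof.
have brw q := hDq 'b_(ie i) 'b_w q; have brx q := hDq 'b_(ie i) 'b_(ix i) q.
rewrite lie_e_xz in brw; rewrite lie_e_x eqxx in brx.
have torus0 x : 2 * x = 0 + 0 -> x = 0 :> K.
  by rewrite addr0 => /eqP; rewrite mulf_eq0 (negPf two_neq0) => /eqP.
apply: Lnn1P => [k|k||k|]; rewrite [RHS]mxE Lbase_coord ?eq_idx ?mulr0.
- have [->|ki] := eqVneq k i.
    have := brx (ie i); rewrite !lie_baseE eqxx !mul1r mulr1 mulrDl mul1r.
    exact: addrI.
  have := brw (ie k); rewrite !lie_baseE (negPf ki) mul0r addr0 mulr0.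
  exact: eq_double_self.
- by apply: torus0; have := brw (ien k); rewrite !lie_baseE.
- have := brw z; rewrite !lie_baseE (half_derivation_xz_nil i).2 oppr0 addr0.
  exact: eq_double_self.
- by apply: torus0; have := brw (ix k); rewrite !lie_baseE.
- by apply: torus0; have := brw w; rewrite !lie_baseE.
Qed.

(** As x_{n+1} commutes with e_{n+i}, the bracket with x_i is needed as well.
    For the coordinate d of D e_{n+i} on e_{2n+1}, the brackets with x_{n+1}
    and x_i give d = - s and 2 d = - s, where s is the coordinate on e_i that
    D x_{n+1} and D x_i share; so both vanish. On e_i, the bracket with x_i
    alone would only give 3 times the coordinate, which x_{n+1} avoids. *)
Lemma half_derivation_en i : D 'b_(ien i) = D 'b_(ix i) 0 (ix i) *: 'b_(ien i).
Proof.
have brw q : 0 = lie (D 'b_(ien i)) 'b_w 0 q + lie 'b_(ien i) (D 'b_w) 0 q.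
  by rewrite -hDq lie_en_xz linear0 mxE mulr0.
have brx q := hDq 'b_(ien i) 'b_(ix i) q.
rewrite lie_en_x eqxx linearN in brx.
have torus0 x : 2 * (- x) = 0 + 0 -> x = 0 :> K.
  rewrite addr0 mulrN => /eqP.
  by rewrite oppr_eq0 mulf_eq0 (negPf two_neq0) => /eqP.
have brwa k : D 'b_(ien i) 0 (ie k) = 0.
  by have := brw (ie k); rewrite !lie_baseE addr0 => <-.
apply: Lnn1P => [k|k||k|]; rewrite [RHS]mxE Lbase_coord ?eq_idx ?mulr0.
- exact: brwa.
- have := brx (ien k); rewrite !lie_baseE !mxE.
  have [->|ki] := eqVneq k i; rewrite ?mul1r ?mul0r ?mulr1 ?mulr0.
    rewrite mulrN mulrDl mul1r -opprD => /oppr_inj; exact: addrI.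
  by rewrite oppr0; apply: torus0.
- have := brx z; rewrite !lie_baseE !mxE add0r -(half_derivation_xz_nil i).1.
  have /esym/eqP := brw z; rewrite !lie_baseE addr_eq0 => /eqP ->.
  by rewrite opprK => ?; rewrite (@eq_double_self (D 'b_w 0 (ie i))) ?oppr0.
- by have := brx (ix k); rewrite !lie_baseE mxE; apply: torus0.
- by have := brx w; rewrite !lie_baseE mxE; apply: torus0.
Qed.

(** Because x_i commutes with e_{2n+1} and x_{n+1} does not. *)
Lemma half_derivation_x_xz i : D 'b_(ix i) 0 w = 0.
Proof.
have := hDq 'b_z 'b_(ix i) z.
by rewrite lie_ez_x linear0 mxE mulr0 !lie_baseE add0r => <-.
Qed.

(** As e_{2n+1} = [e_{n+i}, e_i], its eigenvalue is the mean of those of e_{n+i}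
    and e_i, whatever i is: this is what ties the different i together. *)
Lemma half_derivation_ez i : D 'b_z = D 'b_(ix i) 0 (ix i) *: 'b_z.
Proof.
have br := lie_en_e K i i; rewrite eqxx in br.
apply/rowP => q; apply: (mulfI two_neq0).
rewrite -[in LHS]br hDq half_derivation_en half_derivation_e.
rewrite half_derivation_x_xz addr0.
rewrite lieZl lieZr br !mxE; ring.
Qed.

Lemma half_derivation_x_x i : D 'b_(ix i) 0 (ix i) = D 'b_w 0 w.
Proof.
have := hDq 'b_z 'b_w z.
rewrite lie_ez_xz (half_derivation_ez i) (lie_r_xz _).2 (lie_l_ez _).2.
by rewrite mulrDl mul1r mxE Lbase_coord eqxx mulr1 => /addrI.
Qed.

(** Coordinates of D x_i are detected by bracketing with the e_p, whose images
    are known at this point; the coordinate on e_{2n+1} is detected only by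
    x_{n+1}. *)
Lemma half_derivation_x i : D 'b_(ix i) = D 'b_w 0 w *: 'b_(ix i).
Proof.
apply: Lnn1P => [k|k||k|]; rewrite [RHS]mxE Lbase_coord ?eq_idx ?mulr0.
- have := hDq 'b_(ien k) 'b_(ix i) z; rewrite !lie_baseE add0r => <-.
  rewrite lie_en_x; case: ifP => _; last by rewrite linear0 mxE mulr0.
  by rewrite linearN half_derivation_en !mxE eq_idx andbF mulr0 oppr0 mulr0.
- have := hDq 'b_(ie k) 'b_(ix i) z; rewrite !lie_baseE add0r => /esym/eqP.
  rewrite eqr_oppLR => /eqP ->.
  rewrite lie_e_x; case: ifP => _; last by rewrite linear0 mxE mulr0 oppr0.
  by rewrite half_derivation_e !mxE eq_idx andbF mulr0 mulr0 oppr0.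
- by have := hDc z (lie_x_xz K i); rewrite !lie_baseE.
- have [->|ki] := eqVneq k i; first by rewrite mulr1 half_derivation_x_x.
  have := hDq 'b_(ie k) 'b_(ix i) (ie k).
  rewrite lie_e_x (negPf ki) linear0 !lie_baseE (negPf ki) eqxx mul0r mul1r.
  by rewrite add0r half_derivation_x_xz addr0 mulr0 mxE mulr0 => <-.
- exact: half_derivation_x_xz.
Qed.

(** Nothing detects the coordinate of D x_{n+1} on e_{2n+1}: this is the free
    parameter of the classification. *)
Lemma half_derivation_xz : D 'b_w = D 'b_w 0 w *: 'b_w + D 'b_w 0 z *: 'b_z.
Proof.
apply: Lnn1P => [k|k||k|];
  rewrite [RHS]mxE [X in _ = X + _]mxE [X in _ = _ + X]mxE !Lbase_coord.
all: rewrite ?eq_idx ?eqxx ?mulr0 ?mulr1 ?addr0 ?add0r //.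
- rewrite (half_derivation_xz_nil k).1 half_derivation_x mxE Lbase_coord.
  by rewrite eq_idx mulr0.
- exact: (half_derivation_xz_nil k).2.
have := hDq 'b_(ie k) 'b_w (ie k).
rewrite lie_e_xz !lie_baseE half_derivation_e half_derivation_x_xz addr0.
rewrite half_derivation_x_x mxE Lbase_coord !eqxx mulr1 mul1r mulrDl mul1r.
move=> /addrI/eqP.
by rewrite -[X in X == _]add0r (inj_eq (addIr _)) eq_sym => /eqP.
Qed.

End Classification.

Lemma Lnn1_scalar_shift_base (D : {linear L -> L}) a c :
  (forall p, D 'b_p = a *: 'b_p + (c * (w == p)%:R) *: 'b_z) ->
  forall v : L, D v = a *: v + (c * v 0 w) *: 'b_z.
Proof.
move=> Db v.
rewrite [in LHS](Lbase_sum v) linear_sum [in X in _ = X + _](Lbase_sum v).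
under eq_bigr do rewrite linearZ /= Db scalerDr.
rewrite big_split /= scaler_sumr; congr (_ + _).
  by apply: eq_bigr => p _; rewrite !scalerA mulrC.
rewrite (bigD1 w) //= big1 => [|p pw]; last first.
  by rewrite eq_sym (negPf pw) mulr0 scale0r scaler0.
by rewrite eqxx mulr1 addr0 scalerA mulrC.
Qed.

(** For the converse, the bracket never has an x_{n+1}-coordinate, and the two
    contributions of the shift to [D u, v] + [u, D v] are
    c u(x_{n+1}) v(x_{n+1}) e_{2n+1} with opposite signs. *)
Theorem half_derivation_Lnn1P (D : {linear L -> L}) : (0 < n)%N ->
  half_derivation D <->
  exists a c, forall v : L, D v = a *: v + (c * v 0 w) *: 'b_z.
Proof.
move=> n_gt0; split=> [hD|[a [c Dv]] u v]; last first.
  rewrite !Dv lie_xz_coord mulr0 scale0r addr0 lieDl lieDr !lieZl !lieZr.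
  have lie_z x : lie 'b_z x = x 0 w *: 'b_z.
    apply: Lnn1P => *; rewrite !lie_baseE [RHS]mxE Lbase_coord ?eq_idx ?eqxx;
      by rewrite ?mulr0 ?mulr1.
  rewrite [lie u 'b_z]lieC !lie_z scalerN !scalerA.
  have -> : c * v 0 w * u 0 w = c * u 0 w * v 0 w by ring.
  by rewrite addrACA subrr addr0 -mulr2n -scaler_nat scalerA mulVf ?scale1r.
exists (D 'b_w 0 w), (D 'b_w 0 z); apply: Lnn1_scalar_shift_base => p.
case: (idxP p) => [i|i||i|]; rewrite ?eq_idx ?eqxx ?mulr1 ?mulr0;
  rewrite ?scale0r ?addr0.
- by rewrite half_derivation_e // half_derivation_x_xz // addr0
    half_derivation_x_x.
- by rewrite half_derivation_en // half_derivation_x_x.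
- by rewrite (half_derivation_ez hD (Ordinal n_gt0)) half_derivation_x_x.
- exact: half_derivation_x.
- exact: half_derivation_xz.
Qed.

(** * Local 1/2-derivations *)

(** The shift to e_{2n+1} perturbs coordinates on e_{2n+1} only, and only in the
    presence of x_{n+1}. So the eigenvalue of each other e_p and x_i can be
    compared with that of x_{n+1}, while e_{2n+1} itself has to be compared
    with some e_i. *)
Theorem local_half_derivation_Lnn1 (Delta : {linear L -> L}) : (0 < n)%N ->
  local_half_derivation Delta -> half_derivation Delta.
Proof.
move=> n_gt0 loc; apply/half_derivation_Lnn1P => //.
have shape v : exists a c, Delta v = a *: v + (c * v 0 w) *: 'b_z.
  have [D /(half_derivation_Lnn1P D n_gt0)[a [c Dv]] ->] := loc v.
  by exists a, c; apply: Dv.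
have eig p : p != w -> exists a, Delta 'b_p = a *: 'b_p.
  move=> pw; have [a [c E]] := shape 'b_p; exists a.
  by rewrite E Lbase_coord eq_sym (negPf pw) mulr0 scale0r addr0.
pose a0 := Delta 'b_w 0 w.
have eig_a0 p : p != w -> p != z -> Delta 'b_p = a0 *: 'b_p.
  move=> pw pz; have [a Dp] := eig p pw; rewrite Dp.
  have [b [c Dw]] := shape 'b_w.
  have [b' [c' /rowP Dpw]] := shape ('b_p + 'b_w).
  have [] := (Dpw p, Dpw w); rewrite /a0 linearD Dp Dw !mxE !eqxx !eq_idx /=.
  rewrite (negPf pz) (eq_sym w p) (negPf pw) !(mulr0, mulr1, addr0, add0r).
  by move=> -> ->.
have eig_z : Delta 'b_z = a0 *: 'b_z.
  pose i := Ordinal n_gt0.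
  have [a Dz] : exists a, Delta 'b_z = a *: 'b_z by apply: eig; rewrite eq_idx.
  have [b [c /rowP De]] := shape ('b_(ie i) + 'b_z).
  have [] := (De (ie i), De z).
  rewrite linearD Dz eig_a0 ?eq_idx // !mxE !eqxx !eq_idx /=.
  by rewrite !(mulr0, mulr1, addr0, add0r) => -> ->.
exists a0, (Delta 'b_w 0 z); apply: Lnn1_scalar_shift_base => p.
have [<-|pw] := eqVneq w p; last first.
  rewrite mulr0 scale0r addr0.
  have [->|pz] := eqVneq p z; first exact: eig_z.
  by apply: eig_a0; rewrite // eq_sym.
have [b [c Dw]] := shape 'b_w.
by rewrite /a0 Dw !mxE !eqxx !eq_idx !(mulr0, mulr1, addr0, add0r).
Qed.

End HalfDerivations.

Theorem theorem13 (R : realType) (n : nat) (n_ge1 : (1 <= n)%N)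
    (Delta : {linear Lnn1 R[i] n -> Lnn1 R[i] n}) :
  local_half_derivation Delta -> half_derivation Delta.
Proof.
by apply: local_half_derivation_Lnn1 => //; rewrite Num.Theory.pnatr_eq0.
Qed.
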